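(* Let $\mathcal{L}$ be a variety or quasi-variety of lattice-ordered algebras, let $p(x_1,\ldots,x_m)$ and $q(y_1,\ldots,y_n)$ be terms, where $x_1,\ldots,x_m$ are pairwise distinct variables and $y_1,\ldots,y_n$ are pairwise distinct variables, and let $$p(u_1,\ldots,u_m)\approx q(v_1,\ldots,v_n)$$ be an equation valid in $\mathcal{L}$ which is balanced, i.e. the $u_i$ and $v_j$ are (not necessarily distinct) variables with $\{u_1,\ldots,u_m\}=\{v_1,\ldots,v_n\}$. Let $u$ and $v$ denote the maps $u(x_i)=u_i$ and $v(y_j)=v_j$. Then there are a term $s(z_1,\ldots,z_k)$ in pairwise distinct variables $z_1,\ldots,z_k$ with $k\le mn$, and variable substitutions $\sigma:\{z_1,\ldots,z_k\}\to\{x_1,\ldots,x_m\}$ and $\tau:\{z_1,\ldots,z_k\}\to\{y_1,\ldots,y_n\}$, such that $\mathcal{L}$ satisfies $$p(x_1,\ldots,x_m)\approx s(\sigma z_1,\ldots,\sigma z_k),\qquad q(y_1,\ldots,y_n)\approx s(\tau z_1,\ldots,\tau z_k),$$ and $$u\circ\sigma=v\circ\tau.$$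
   Context: A (quasi-)variety of lattice-ordered algebras is a (quasi-)variety $\mathcal{L}$ of algebras with finitary operations whose signature contains binary operations $\vee,\wedge$ satisfying the lattice axioms, and such that in every algebra of $\mathcal{L}$ all additional operations are monotone in each argument with respect to the lattice order. Terms are terms in the signature of $\mathcal{L}$, and $\approx$ denotes an equation holding in all algebras of $\mathcal{L}$ (equivalently, equality in the free algebra of $\mathcal{L}$ over the variables involved). Writing a term as $p(x_1,\ldots,x_m)$ means that its variables are among $x_1,\ldots,x_m$, and $p(u_1,\ldots,u_m)$ is the result of substituting $u_i$ for $x_i$. *)

(* Defs.v *)
From Stdlib Require List.
From mathcomp Require Import all_boot.

Set Implicit Arguments.
Unset Strict Implicit.
Unset Printing Implicit Defensive.

(** Only the additional operation symbols are listed; the binary symbols for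
    join and meet belong to every signature and are built into [term] and
    [algebra].  All operations are finitary; arity 0 (constants) is allowed. *)
Record signature := Signature {
  op : Type;
  arity : op -> nat
}.

(** [term S V] is the set of terms with variables among [V].  A term written
    p(x_1, ..., x_m) with pairwise distinct x_i is a [term S 'I_m], the
    variable x_i being the index i; it need not use all its variables. *)
Inductive term (S : signature) (V : Type) : Type :=
| Var of V
| Join of term S V & term S V
| Meet of term S V & term S V
| Op (f : op S) of 'I_(arity f) -> term S V.

Arguments Var {S V} _.
Arguments Join {S V} _ _.
Arguments Meet {S V} _ _.
Arguments Op {S V} f _.

Fixpoint rename (S : signature) (V W : Type) (g : V -> W) (t : term S V) :
    term S W :=
  match t with
  | Var x => Var (g x)
  | Join t1 t2 => Join (rename g t1) (rename g t2)
  | Meet t1 t2 => Meet (rename g t1) (rename g t2)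
  | Op f a => Op f (fun i => rename g (a i))
  end.

(** The carrier may be empty: an empty algebra satisfies every equation, so
    excluding it would not change which equations hold in a class. *)
Record algebra (S : signature) := Algebra {
  carrier :> Type;
  join : carrier -> carrier -> carrier;
  meet : carrier -> carrier -> carrier;
  interp : forall f : op S, {ffun 'I_(arity f) -> carrier} -> carrier
}.

Fixpoint eval (S : signature) (A : algebra S) (V : Type) (e : V -> A)
    (t : term S V) : A :=
  match t with
  | Var x => e x
  | Join t1 t2 => join (eval e t1) (eval e t2)
  | Meet t1 t2 => meet (eval e t1) (eval e t2)
  | Op f a => interp [ffun i => eval e (a i)]
  end.

Definition valid (S : signature) (L : algebra S -> Prop) (V : Type)
    (t1 t2 : term S V) : Prop :=
  forall A : algebra S, L A -> forall e : V -> A, eval e t1 = eval e t2.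

(** Axioms are written over the countable set [nat] of variables. *)
Definition equation (S : signature) : Type := (term S nat * term S nat)%type.

Record quasi_equation (S : signature) := QuasiEquation {
  premises : seq (equation S);
  conclusion : equation S
}.

Definition holds_at (S : signature) (A : algebra S) (e : nat -> A)
    (E : equation S) : Prop :=
  eval e E.1 = eval e E.2.

Definition satisfies_eq (S : signature) (A : algebra S) (E : equation S) :
    Prop :=
  forall e : nat -> A, holds_at e E.

Definition satisfies_qeq (S : signature) (A : algebra S)
    (Q : quasi_equation S) : Prop :=
  forall e : nat -> A,
    (forall E, List.In E (premises Q) -> holds_at e E) ->
    holds_at e (conclusion Q).

Definition variety (S : signature) (L : algebra S -> Prop) : Prop :=
  exists Ax : equation S -> Prop,
    forall A, L A <-> (forall E, Ax E -> satisfies_eq A E).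

Definition quasi_variety (S : signature) (L : algebra S -> Prop) : Prop :=
  exists Ax : quasi_equation S -> Prop,
    forall A, L A <-> (forall Q, Ax Q -> satisfies_qeq A Q).

Definition lattice_axioms (S : signature) (A : algebra S) : Prop :=
  [/\ commutative (@join S A) /\ commutative (@meet S A),
      associative (@join S A) /\ associative (@meet S A),
      forall x y : A, join x (meet x y) = x
    & forall x y : A, meet x (join x y) = x].

Definition lat_le (S : signature) (A : algebra S) (x y : A) : Prop :=
  meet x y = x.

Definition monotone_in_each_argument (S : signature) (A : algebra S)
    (f : op S) : Prop :=
  forall (i : 'I_(arity f)) (a b : {ffun 'I_(arity f) -> A}),
    (forall j, j != i -> a j = b j) -> lat_le (a i) (b i) ->
    lat_le (interp a) (interp b).

Definition lattice_ordered (S : signature) (A : algebra S) : Prop :=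
  lattice_axioms A /\ forall f : op S, monotone_in_each_argument A f.

(* Main.v *)
Require Import Defs.
From mathcomp Require Import all_boot.

Set Implicit Arguments.
Unset Strict Implicit.
Unset Printing Implicit Defensive.

(** Take for z_1, ..., z_k the pairs (x_i, y_j) with u_i = v_j, and for sigma
    and tau the two projections.  Balancedness says that both projections are
    onto, and u \o sigma = v \o tau holds by construction.  Put

      p' = p (x_i := the meet of the z above x_i),
      q' = q (y_j := the meet of the z above y_j),      s = p' \/ q'.

    Renaming z to sigma z turns each meet above x_i into x_i, so it sends p'
    to p ([eval_lift_meet]).  Renaming z to tau z turns the meet above x_i into
    the meet of the y_j with v_j = u_i, which depends on u_i alone; hence p' is
    sent to an instance of p(u_1, ..., u_m), which by the given equation is the
    corresponding instance of q(v_1, ..., v_n), namely q evaluated at elements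
    below y_1, ..., y_n.  Since terms are monotone, p' is sent below q
    ([eval_lift_meet_le]).  By symmetry q' is sent to q by tau and below p by
    sigma, so s is sent to p by sigma and to q by tau. *)

Section Evaluation.

Variables (S : signature) (A : algebra S).

Lemma eq_eval (V : Type) (e1 e2 : V -> A) (t : term S V) :
  e1 =1 e2 -> eval e1 t = eval e2 t.
Proof.
move=> e12; elim: t => [x|t1 IH1 t2 IH2|t1 IH1 t2 IH2|f a IH] /=.
- exact: e12.
- by rewrite IH1 IH2.
- by rewrite IH1 IH2.
- by congr interp; apply/ffunP=> i; rewrite !ffunE IH.
Qed.

Lemma eval_rename (V W : Type) (g : V -> W) (e : W -> A) (t : term S V) :
  eval e (rename g t) = eval (e \o g) t.
Proof.
elim: t => [x|t1 IH1 t2 IH2|t1 IH1 t2 IH2|f a IH] //=; first by rewrite IH1 IH2.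
  by rewrite IH1 IH2.
by congr interp; apply/ffunP=> i; rewrite !ffunE IH.
Qed.

Fixpoint subst (V W : Type) (g : V -> term S W) (t : term S V) : term S W :=
  match t with
  | Var x => g x
  | Join t1 t2 => Join (subst g t1) (subst g t2)
  | Meet t1 t2 => Meet (subst g t1) (subst g t2)
  | Op f a => Op f (fun i => subst g (a i))
  end.

Lemma eval_subst (V W : Type) (g : V -> term S W) (e : W -> A)
    (t : term S V) :
  eval e (subst g t) = eval (fun x => eval e (g x)) t.
Proof.
elim: t => [x|t1 IH1 t2 IH2|t1 IH1 t2 IH2|f a IH] //=; first by rewrite IH1 IH2.
  by rewrite IH1 IH2.
by congr interp; apply/ffunP=> i; rewrite !ffunE IH.
Qed.

End Evaluation.

Section LatticeOrder.

Variables (S : signature) (A : algebra S).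
Hypothesis A_lattice : lattice_axioms A.

Lemma lat_le_refl (x : A) : lat_le x x.
Proof.
have [_ _ joinKI meetKU] := A_lattice.
by rewrite /lat_le -{2}(joinKI x x) meetKU.
Qed.

Lemma lat_le_trans (y x z : A) : lat_le x y -> lat_le y z -> lat_le x z.
Proof.
have [_ [_ meetA] _ _] := A_lattice.
by rewrite /lat_le => xy yz; rewrite -xy -meetA yz.
Qed.

Lemma lat_le_anti (x y : A) : lat_le x y -> lat_le y x -> x = y.
Proof.
have [[_ meetC] _ _ _] := A_lattice.
by rewrite /lat_le => xy yx; rewrite -xy meetC.
Qed.

Lemma lat_le_meetl (x y : A) : lat_le (meet x y) x.
Proof.
have [[_ meetC] [_ meetA] _ _] := A_lattice.
by rewrite /lat_le meetC meetA lat_le_refl.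
Qed.

Lemma lat_le_meetr (x y : A) : lat_le (meet x y) y.
Proof.
by have [[_ meetC] _ _ _] := A_lattice; rewrite meetC; apply: lat_le_meetl.
Qed.

Lemma lat_le_meetP (x y z : A) :
  lat_le z x -> lat_le z y -> lat_le z (meet x y).
Proof.
have [_ [_ meetA] _ _] := A_lattice.
by rewrite /lat_le => zx zy; rewrite meetA zx zy.
Qed.

Lemma join_idPl (x y : A) : lat_le y x -> join x y = x.
Proof.
have [[_ meetC] _ joinKI _] := A_lattice.
by rewrite /lat_le => yx; rewrite -yx meetC joinKI.
Qed.

Lemma join_idPr (x y : A) : lat_le x y -> join x y = y.
Proof.
by have [[joinC _] _ _ _] := A_lattice; rewrite joinC; apply: join_idPl.
Qed.

Lemma lat_le_meet2 (x1 x2 y1 y2 : A) :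
  lat_le x1 y1 -> lat_le x2 y2 -> lat_le (meet x1 x2) (meet y1 y2).
Proof.
move=> le1 le2; apply: lat_le_meetP.
- exact: lat_le_trans (lat_le_meetl _ _) le1.
- exact: lat_le_trans (lat_le_meetr _ _) le2.
Qed.

Lemma lat_le_join2 (x1 x2 y1 y2 : A) :
  lat_le x1 y1 -> lat_le x2 y2 -> lat_le (join x1 x2) (join y1 y2).
Proof.
have [_ [joinA _] _ meetKU] := A_lattice; have [[joinC _] _ _ _] := A_lattice.
move=> /join_idPr le1 /join_idPr le2.
have ->: join y1 y2 = join (join x1 x2) (join y1 y2).
  by rewrite -joinA (joinA x2) (joinC x2) -joinA le2 joinA le1.
by rewrite /lat_le meetKU.
Qed.

End LatticeOrder.

Section Monotone.

Variables (S : signature) (A : algebra S).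
Hypothesis A_ordered : lattice_ordered A.

(** Monotonicity is given one argument at a time, so the arguments of [a] are
    replaced by those of [b] one after the other. *)
Lemma interp_mono (f : op S) (a b : {ffun 'I_(arity f) -> A}) :
  (forall i, lat_le (a i) (b i)) -> lat_le (interp a) (interp b).
Proof.
have [A_lat /(_ f) mono] := A_ordered => ab.
pose c k := [ffun i : 'I_(arity f) => if i < k then b i else a i].
have -> : b = c (arity f) by apply/ffunP=> i; rewrite ffunE ltn_ord.
suff: forall k, k <= arity f -> lat_le (interp a) (interp (c k)).
  by apply.
elim=> [_|k IH lt_k].
  have -> : c 0 = a by apply/ffunP=> i; rewrite ffunE ltn0.
  exact: lat_le_refl.
apply: (lat_le_trans A_lat (IH (ltnW lt_k))).
apply: (mono (Ordinal lt_k)) => [j|]; last by rewrite !ffunE /= ltnn ltnSn.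
by rewrite -val_eqE !ffunE /= ltnS (leq_eqVlt j) => /negbTE ->.
Qed.

Lemma eval_mono (V : Type) (e1 e2 : V -> A) (t : term S V) :
  (forall x, lat_le (e1 x) (e2 x)) -> lat_le (eval e1 t) (eval e2 t).
Proof.
have [A_lat _] := A_ordered => e12.
elim: t => [x|t1 IH1 t2 IH2|t1 IH1 t2 IH2|f a IH] /=.
- exact: e12.
- exact: lat_le_join2.
- exact: lat_le_meet2.
- by apply: interp_mono => i; rewrite !ffunE.
Qed.

End Monotone.

(** The signature has no top element, so the meet over a fibre of [sigma] needs
    a starting point: [sec] is meant to be a section of [sigma]. *)
Definition fiber_meet (S : signature) (I K : finType) (sigma : K -> I)
    (sec : I -> K) (i : I) : term S K :=
  foldr (fun z t => Meet (Var z) t) (Var (sec i))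
        [seq z <- enum K | sigma z == i].

Definition lift_meet (S : signature) (I K : finType) (sigma : K -> I)
    (sec : I -> K) (t : term S I) : term S K :=
  subst (@fiber_meet S I K sigma sec) t.

Section FiberMeet.

Variables (S : signature) (A : algebra S) (I K : finType).
Variables (sigma : K -> I) (sec : I -> K).
Hypothesis A_lattice : lattice_axioms A.

Lemma fiber_meet_le (e : K -> A) (z : K) :
  lat_le (eval e (fiber_meet S sigma sec (sigma z))) (e z).
Proof.
have: z \in [seq z' <- enum K | sigma z' == sigma z].
  by rewrite mem_filter eqxx mem_enum.
rewrite /fiber_meet; elim: [seq _ <- _ | _] => //= z' r IH.
rewrite inE => /predU1P[->|/IH]; first exact: lat_le_meetl.
by apply: lat_le_trans => //; apply: lat_le_meetr.
Qed.

Lemma le_fiber_meet (e : K -> A) (i : I) (c : A) :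
    cancel sec sigma -> (forall z, sigma z = i -> lat_le c (e z)) ->
  lat_le c (eval e (fiber_meet S sigma sec i)).
Proof.
move=> secK le_c; rewrite /fiber_meet.
elim: (enum K) => [|z r IH] /=; first exact/le_c/secK.
case: eqP => [/le_c cz|_] //=; exact: lat_le_meetP.
Qed.

Lemma eval_lift_meet (e : I -> A) (t : term S I) :
  cancel sec sigma -> eval (e \o sigma) (lift_meet sigma sec t) = eval e t.
Proof.
move=> secK; rewrite eval_subst; apply: eq_eval => i.
apply: (lat_le_anti A_lattice).
- by have := fiber_meet_le (e \o sigma) (sec i); rewrite /= secK.
- by apply: le_fiber_meet => // z /= ->; apply: lat_le_refl.
Qed.

End FiberMeet.

(** The values of the meets above the x_i, computed along [tau], are squeezed
    through an assignment [w] of the variables of the common equation.  That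
    assignment picks one x_i for each value of [u]; the choice does not matter
    because [sigma] and [tau] form a weak pullback of [u] and [v]. *)
Lemma eval_lift_meet_le (S : signature) (A : algebra S) (I J K : finType)
    (T : eqType) (u : I -> T) (v : J -> T) (sigma : K -> I) (tau : K -> J)
    (sec : I -> K) (p : term S I) (q : term S J) (e : J -> A) :
    lattice_ordered A ->
    (forall w : T -> A, eval (w \o u) p = eval (w \o v) q) ->
    cancel sec sigma -> (forall j, exists i, u i = v j) ->
    u \o sigma =1 v \o tau ->
    (forall i j, u i = v j -> exists2 z, sigma z = i & tau z = j) ->
  lat_le (eval (e \o tau) (lift_meet sigma sec p)) (eval e q).
Proof.
move=> A_ord pq secK v_sub_u square pullback; have [A_lat _] := A_ord.
pose m i := eval (e \o tau) (fiber_meet S sigma sec i).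
(* A may have no other known element when there are no variables at all, so
   the value of q itself serves as the junk value of w. *)
pose w t := if [pick i | u i == t] is Some i then m i else eval e q.
have m_le_w i : lat_le (m i) (w (u i)).
  rewrite /w; case: pickP => [i' /eqP u_i'|/(_ i)]; last by rewrite eqxx.
  apply: le_fiber_meet => // z sigma_z.
  have [|z' <- /= <-] := pullback i (tau z).
    by rewrite -u_i' -sigma_z; apply: square.
  exact: (fiber_meet_le _ _ _ (e \o tau)).
have w_le_e j : lat_le (w (v j)) (e j).
  rewrite /w; case: pickP => [i /eqP /pullback[z <- <-]|no_i].
    exact: (fiber_meet_le _ _ _ (e \o tau)).
  by have [i u_i] := v_sub_u j; have := no_i i; rewrite u_i eqxx.
rewrite eval_subst; apply: (lat_le_trans A_lat (y := eval (w \o u) p)).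
  exact: eval_mono.
by rewrite pq; apply: eval_mono.
Qed.

Theorem theorem13 (S : signature) (L : algebra S -> Prop)
    (L_qvariety : variety L \/ quasi_variety L)
    (L_lattice_ordered : forall A : algebra S, L A -> lattice_ordered A)
    (m n : nat) (p : term S 'I_m) (q : term S 'I_n)
    (u : 'I_m -> nat) (v : 'I_n -> nat)
    (pq_valid : valid L (rename u p) (rename v q))
    (pq_balanced : codom u =i codom v) :
  exists (k : nat) (s : term S 'I_k) (sigma : 'I_k -> 'I_m)
         (tau : 'I_k -> 'I_n),
    [/\ k <= m * n,
        valid L p (rename sigma s),
        valid L q (rename tau s)
      & u \o sigma =1 v \o tau].
Proof.
pose Z := [set ij : 'I_m * 'I_n | u ij.1 == v ij.2].
pose sigma (z : 'I_#|Z|) := (enum_val z).1.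
pose tau (z : 'I_#|Z|) := (enum_val z).2.
have square : u \o sigma =1 v \o tau.
  by move=> z; apply/eqP; have := enum_valP z; rewrite inE.
have pullback i j : u i = v j -> exists2 z, sigma z = i & tau z = j.
  move=> uv; have ij_Z : (i, j) \in Z by rewrite inE /= uv.
  by exists (enum_rank_in ij_Z (i, j)); rewrite /sigma /tau enum_rankK_in.
have v_sub_u j : exists i, u i = v j.
  have /codomP[i ->] : v j \in codom u by rewrite pq_balanced codom_f.
  by exists i.
have u_sub_v i : exists j, v j = u i.
  have /codomP[j ->] : u i \in codom v by rewrite -pq_balanced codom_f.
  by exists j.
have /fin_all_exists[secl seclK] i : exists z, sigma z = i.
  by have [j /esym/pullback[z]] := u_sub_v i; exists z.
have /fin_all_exists[secr secrK] j : exists z, tau z = j.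
  by have [i /pullback[z]] := v_sub_u j; exists z.
have pq (A : algebra S) : L A -> forall w : nat -> A,
    eval (w \o u) p = eval (w \o v) q.
  by move=> LA w; have := pq_valid A LA w; rewrite !eval_rename.
exists #|Z|, (Join (lift_meet sigma secl p) (lift_meet tau secr q)), sigma, tau.
split=> //.
- by rewrite (leq_trans (max_card _)) // card_prod !card_ord.
- move=> A LA e; have [A_lat _] := L_lattice_ordered A LA.
  rewrite eval_rename /= eval_lift_meet // join_idPl //.
  apply: (eval_lift_meet_le (u := v) (v := u)) => //.
  + exact: L_lattice_ordered.
  + by move=> w; rewrite pq.
  + by move=> j i /esym/pullback[z ? ?]; exists z.
- move=> A LA e; have [A_lat _] := L_lattice_ordered A LA.
  rewrite eval_rename /= [eval _ (lift_meet tau _ _)]eval_lift_meet //.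
  rewrite join_idPr //.
  apply: (eval_lift_meet_le (u := u) (v := v)) => //.
  + exact: L_lattice_ordered.
  + exact: pq.
Qed.
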